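(* The framed Jones polynomial of a signed arrangement is a hyperplane Reidemeister invariant: if two signed vector arrangements $\mathcal V$ and $\mathcal V'$ over $\Bbbk$ are related by one of the moves $wR1$, $wR1^\vee$, $R2$, $R2^\vee$, $R3$, $R3^\vee$, then $J(\mathcal V)=J(\mathcal V')$.
   Context: Let $\Bbbk$ be a field of characteristic zero. A signed vector arrangement $\mathcal V=\{V;\nu_1,\dots,\nu_n\}$ is a finite-dimensional $\Bbbk$-vector space $V$ with an inner product, a list of vectors $\nu_i\in V$ (zero allowed) and a sign $+$ or $-$ for each $\nu_i$; $[n]=[n]_+\sqcup[n]_-$ is the resulting partition of $[n]=\{1,\dots,n\}$. For $S\subseteq[n]$ put $H_S=\bigcap_{s\in S}\nu_s^\perp$ ($H_\emptyset=V$), $W=\{w\in\Bbbk^n:\sum w_i\nu_i=0\}$, $W_S=\{w\in W:w_r=0\ \text{for}\ r\notin S\}$, and $\widetilde S=(S\cap[n]_+)\cup([n]_-\setminus S)$. The inner product is understood to restrict non-degenerately to all subspaces onto which orthogonal projections are taken. Framed Jones polynomial (in $\mathbb Z[i,q^{1/2},q^{-1/2}]$, $i=\sqrt{-1}$, $(-1)^{1/2}=i$): $$J(\mathcal V)=\sum_{S\subseteq[n]}(-1)^{|S|-n/2}q^{|S|-n/2}(q+q^{-1})^{\dim H_{\widetilde S}+\dim W_{\widetilde S}}.$$ $\nu_i^\vee$ denotes the coordinate functional $w\mapsto w_i$ on $W$. Deletion $\mathcal V-\{\dots\}$ removes vectors. The restriction $\mathcal V^{\nu_l}$ is the arrangement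 in $\nu_l^\perp$ consisting of the orthogonal projections of the $\nu_j$, $j\ne l$; $\mathcal V^{\{\nu_l,\nu_m\}}$ is the arrangement in $\nu_l^\perp\cap\nu_m^\perp$ consisting of the orthogonal projections of the remaining vectors. Remaining vectors keep their signs. Moves: - $wR1$: if $\nu_l=\nu_m=0$ with $l,m$ of opposite signs, $\mathcal V\leftrightarrow\mathcal V-\{\nu_l,\nu_m\}$. - $wR1^\vee$: if $\nu_l^\vee=\nu_m^\vee=0$ with $l,m$ of opposite signs, $\mathcal V\leftrightarrow\mathcal V^{\{\nu_l,\nu_m\}}$. - $R2$: if $\nu_l=\alpha\nu_m$ with $0\neq\alpha\in\Bbbk$ and $l\neq m$ of opposite signs, $\mathcal V\leftrightarrow\mathcal V-\{\nu_l,\nu_m\}$. - $R2^\vee$: if $\nu_l^\vee=\alpha\nu_m^\vee$ with $0\ne\alpha\in\Bbbk$ and $l\ne m$ of opposite signs, $\mathcal V\leftrightarrow\mathcal V^{\{\nu_l,\nu_m\}}$. - $R3$: if $\nu_l,\nu_m,\nu_p$ are three distinct vectors in $\mathcal V$ with $l,m\in[n]_+$, $p\in[n]_-$, and $\nu_l^\vee=\alpha_m\nu_m^\vee+\alpha_p\nu_p^\vee$ with $\alpha_m,\alpha_p\neq0$, then $\mathcal V\leftrightarrow\mathcal V'$, where $\mathcal V'$ is obtained from $\mathcal V^{\nu_l}$ by adding an extra vector $\nu_l'=\alpha_p\nu_m-\alpha_m\nu_p$ (with $\nu_m,\nu_p$ projected to $\nu_l^\perp$) of negative sign, other signs unchanged.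 - $R3^\vee$: the same as $R3$ with all signs reversed ($l,m\in[n]_-$, $p\in[n]_+$, $\nu_l'$ positive).
   Formalization: In R2^∨ the vectors ν_l and ν_m are additionally assumed not proportional; otherwise J(V) = (q+q⁻¹)J(V^{ν_l,ν_m}) and the claim fails, e.g. ν_1 = ν_2 = 1 of opposite signs in a line, where J(V) = q+q⁻¹ but the restriction has J = 1. *)

(* Defs.v *)
From HB Require Import structures.
From mathcomp Require Import all_boot all_order all_algebra all_field.

Set Implicit Arguments.
Unset Strict Implicit.
Unset Printing Implicit Defensive.

Import GRing.Theory.
Local Open Scope ring_scope.

(* An inner product over a general field is a nondegenerate symmetric bilinear
   form (no positivity is available).  [pos A] is the set [n]_+ of indices of
   positive sign; [n]_- is its complement.  Indices start from 0. *)
Record arrangement (K : fieldType) := Arrangement {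
  ambient : vectType K;
  dot : {symmetric ambient};
  dot_nondeg : nondegenerate dot;
  nvec : nat;
  vec : 'I_nvec -> ambient;
  pos : {set 'I_nvec}
}.

Section RestrictedForm.
Variables (K : fieldType) (V : vectType K) (f : {symmetric V}) (U : {vspace V}).

Definition subdot (u v : subvs_of U) : K := f (vsval u) (vsval v).

Lemma subdot_bilinear : bilinear_for *%R *%R subdot.
Proof.
by split=> [u a v w|v a u w]; rewrite /subdot linearP /= ?linearPl ?linearPr.
Qed.

HB.instance Definition _ :=
  bilinear_isBilinear.Build K (subvs_of U) (subvs_of U) K *%R *%R
    subdot subdot_bilinear.

Lemma subdot_hermitian u v : subdot u v = (-1) ^+ false * subdot v u.
Proof. by rewrite /subdot hermC. Qed.

HB.instance Definition _ :=
  isHermitianSesquilinear.Build K (subvs_of U) false idfun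
    subdot subdot_hermitian.

Definition restricted_dot : {symmetric (subvs_of U)} := subdot.

Lemma restricted_dot_nondeg :
  (U :&: orthov f U == 0)%VS -> nondegenerate restricted_dot.
Proof.
move=> /eqP UU0; rewrite /nondegenerate -subv0; apply/subvP => u.
move/mem_orthovP => ortho_u; rewrite memv0 -(inj_eq subvs_inj) raddf0.
rewrite -memv0 -UU0 memv_cap subvsP; apply/mem_orthovP => v vU.
have /= := ortho_u (vsproj U v) (memvf _).
by rewrite /subdot vsprojK.
Qed.

(* Orthogonal projection onto U, meaningful when f is nondegenerate on U. *)
Definition oproj (v : V) : subvs_of U :=
  vsproj U (daddv_pi U (orthov f U) v).

End RestrictedForm.

Section Arrangement.
Variables (K : fieldType) (A : arrangement K).
Notation n := (nvec A).
Implicit Type S : {set 'I_n}.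

Definition flat S : {vspace ambient A} :=
  (\bigcap_(s in S) orthov (dot A) <[vec s]>)%VS.

Definition lincomb (w : 'rV[K]_n) : ambient A := \sum_i w 0 i *: vec i.

Lemma lincomb_linear : linear lincomb.
Proof.
move=> a u v; rewrite /lincomb scaler_sumr -big_split /=.
by apply: eq_bigr => i _; rewrite !mxE scalerDl scalerA.
Qed.

HB.instance Definition _ :=
  GRing.isLinear.Build K 'rV[K]_n (ambient A) _ lincomb lincomb_linear.

Definition entry (i : 'I_n) (w : 'rV[K]_n) : K^o := w 0 i.

Lemma entry_linear i : linear (entry i).
Proof. by move=> a u v; rewrite /entry !mxE. Qed.

HB.instance Definition _ i :=
  GRing.isLinear.Build K 'rV[K]_n K^o _ (entry i) (entry_linear i).

Definition relations : {vspace 'rV[K]_n} := lker (linfun lincomb).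

Definition relations_on S : {vspace 'rV[K]_n} :=
  (relations :&: \bigcap_(r in ~: S) lker (linfun (entry r)))%VS.

Definition covec (i : 'I_n) : 'Hom(subvs_of relations, K^o) :=
  (linfun (entry i) \o linfun vsval)%VF.

Lemma mem_relations w :
  (w \in relations) = (\sum_i w 0 i *: @vec K A i == 0).
Proof. by rewrite memv_ker lfunE. Qed.

Lemma mem_relations_on S w :
  reflect (w \in relations /\ forall r, r \notin S -> w 0 r = 0)
          (w \in relations_on S).
Proof.
rewrite memv_cap; apply: (iffP andP) => -[wW wS]; split=> //.
  move=> r rS; move: wS; rewrite memvE => /subv_bigcapP/(_ r).
  by rewrite inE -memvE memv_ker lfunE => /(_ rS)/eqP.
rewrite memvE; apply/subv_bigcapP => r; rewrite inE => /wS wr.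
by rewrite -memvE memv_ker lfunE /= /entry wr.
Qed.

Lemma covecE i (w : subvs_of relations) : covec i w = vsval w 0 i.
Proof. by rewrite comp_lfunE !lfunE. Qed.

Definition twist S : {set 'I_n} := (S :&: pos A) :|: (~: pos A :\: S).

(* The ring Z[i, q^{1/2}, q^{-1/2}] is viewed inside the field of rational
   functions in q^{1/2} over the algebraic numbers.  With (-1)^{1/2} = i, the
   factors (-1)^{|S|-n/2} and q^{|S|-n/2} are the integral powers of exponent
   2|S| - n of i and q^{1/2}. *)
Definition sqrtq : {fraction {poly algC}} := tofrac 'X.
Definition imag : {fraction {poly algC}} := tofrac ('i%:P).

Definition framed_jones : {fraction {poly algC}} :=
  let q := sqrtq ^+ 2 in
  \sum_(S : {set 'I_n})
    imag ^ ((#|S|.*2)%:Z - n%:Z) * sqrtq ^ ((#|S|.*2)%:Z - n%:Z) *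
    (q + q^-1) ^+ (\dim (flat (twist S)) + \dim (relations_on (twist S))).

(* The remaining vectors are renumbered in increasing order by [enum_val]. *)
Definition deletion (D : {set 'I_n}) : arrangement K :=
  @Arrangement K (ambient A) (dot A) (dot_nondeg A) #|~: D|
    (fun i => vec (enum_val i)) [set i | enum_val i \in pos A].

Definition nondeg_on (U : {vspace ambient A}) : bool :=
  (U :&: orthov (dot A) U == 0)%VS.

Definition restriction (D : {set 'I_n}) (ndD : nondeg_on (flat D)) :
    arrangement K :=
  @Arrangement K (subvs_of (flat D)) (restricted_dot (dot A) (flat D))
    (restricted_dot_nondeg ndD) #|~: D|
    (fun i => oproj (dot A) (flat D) (vec (enum_val i)))
    [set i | enum_val i \in pos A].

(* The extra vector is appended at the end of the list; it is positive iff
   [s] is true. *)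
Definition extension (v : ambient A) (s : bool) : arrangement K :=
  @Arrangement K (ambient A) (dot A) (dot_nondeg A) n.+1
    (fun i => if unlift ord_max i is Some j then vec j else v)
    [set i | if unlift ord_max i is Some j then j \in pos A else s].

Definition opposite_signs (l m : 'I_n) : bool :=
  (l \in pos A) != (m \in pos A).

End Arrangement.

Arguments restriction {K} A D ndD.
Arguments deletion {K} A D.
Arguments extension {K} A v s.

(* In both moves of type R3 the new vector has the sign opposite to that of
   nu_l; [s] is true iff it is positive. *)
Definition R3_target (K : fieldType) (A : arrangement K) (l m p : 'I_(nvec A))
    (am ap : K) (ndl : nondeg_on (flat [set l])) (s : bool) : arrangement K :=
  let pr := oproj (dot A) (flat [set l]) in
  extension (restriction A [set l] ndl)
    (ap *: pr (vec m) - am *: pr (vec p)) s.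

(* The condition that nu_l and nu_m are not proportional in [R2_dual] cannot be
   dropped.  If they are, then flat [set l; m] has codimension 1 and
   J(A) = (q + q^-1) J(restriction A [set l; m]), as for nu_1 = nu_2 = 1 in a
   line: there J(A) = q + q^-1, while the restriction is the empty arrangement
   in the zero space and has J = 1. *)
Inductive reidemeister (K : fieldType) (A : arrangement K) :
    arrangement K -> Prop :=
| wR1 (l m : 'I_(nvec A)) :
    vec l = 0 -> vec m = 0 -> opposite_signs l m ->
    reidemeister A (deletion A [set l; m])
| wR1_dual (l m : 'I_(nvec A)) (nd : nondeg_on (flat [set l; m])) :
    covec l = 0 -> covec m = 0 -> opposite_signs l m ->
    reidemeister A (restriction A [set l; m] nd)
| R2 (l m : 'I_(nvec A)) (a : K) :
    a != 0 -> vec l = a *: vec m -> opposite_signs l m ->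
    reidemeister A (deletion A [set l; m])
| R2_dual (l m : 'I_(nvec A)) (a : K) (nd : nondeg_on (flat [set l; m])) :
    a != 0 -> covec l = a *: covec m -> opposite_signs l m ->
    vec l \notin <[vec m]>%VS ->
    reidemeister A (restriction A [set l; m] nd)
| R3 (l m p : 'I_(nvec A)) (am ap : K) (nd : nondeg_on (flat [set l])) :
    l != m -> l \in pos A -> m \in pos A -> p \notin pos A ->
    am != 0 -> ap != 0 -> covec l = am *: covec m + ap *: covec p ->
    reidemeister A (R3_target m p am ap nd false)
| R3_dual (l m p : 'I_(nvec A)) (am ap : K) (nd : nondeg_on (flat [set l])) :
    l != m -> l \notin pos A -> m \notin pos A -> p \in pos A ->
    am != 0 -> ap != 0 -> covec l = am *: covec m + ap *: covec p ->
    reidemeister A (R3_target m p am ap nd true).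

(* Main.v *)
Require Import Defs.
From mathcomp Require Import all_boot all_order all_algebra all_field.
From mathcomp Require Import ring zify.
Import GRing.Theory.
Local Open Scope ring_scope.

Set Implicit Arguments.
Unset Strict Implicit.
Unset Printing Implicit Defensive.

(** The framed Jones polynomial is a Kauffman bracket.  Put
    u = (-1)^(1/2) q^(1/2) and d = q + q^-1, so that d = - (u^2 + u^-2).  If the
    states are indexed by T = twist S instead of S, then a positive index
    contributes u when it belongs to T and u^-1 when it does not, a negative
    index the other way round, and the two dimensions depend only on the rank of
    the vectors indexed by T: dim (flat T) = dim V - rk T because the form is
    nondegenerate, and dim (relations_on T) = #|T| - rk T by rank-nullity.
    Hence ([framed_jonesE]) J(A) is the sum over T of
      (product of the weights) * d ^ (dim V + #|T| - 2 rk T).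

    This is a function of the signed matroid and of dim V only.  Deleting a set
    of vectors restricts the sum to the states that avoid it
    ([framed_jones_deletion]).  Orthogonal projection onto flat D has kernel
    span D, so it replaces rk T by rk (T :|: D) - rk D, which is matroid
    contraction ([framed_jones_restriction]).

    Each move is then a local computation: fix the part T of a state away from
    the two or three indices that the move involves, and sum over the 4 or 8
    ways to complete it.
    - Two parallel vectors (or two zero vectors) of opposite signs: the states
      that use at least one of them cancel, since adding the second vector to
      the first multiplies a term by d = - (u^2 + u^-2)
      ([state_sum_parallel]).
    - Two vectors in series (or two coloops) of opposite signs: adding one of
      them to T raises the rank and divides the term by d, so that the state
      with none cancels the two states with one.  The state with both remains;
      it is the state T of the contraction ([state_sum_series]).
    - For R3, the relation between the covectors makes l, m and p a triad (up to
      coloops), and in the contraction by l the vectors m, p and the new one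
      are linearly dependent.  The ranks of the 8 completions on either side
      match as in the star-triangle relation, whatever the position of these
      vectors relative to span T ([state_sum_triangle]). *)

(** * State sums *)

Section StateSum.
Variables (F : fieldType) (u : F).

Definition spin_weight (b : bool) : F := if b then u else u^-1.

(** Only the indices of [Y] are weighted, so that splitting off one index
    relates a sum over [x |: Y] to a sum over [Y] for a new summand. *)
Definition state_sum (I : finType) (P Y : {set I}) (f : {set I} -> F) : F :=
  \sum_(T : {set I} | T \subset Y)
    (\prod_(i in Y) spin_weight ((i \in T) == (i \in P))) * f T.

Lemma eq_state_sum (I : finType) (P Y : {set I}) (f g : {set I} -> F) :
    (forall T : {set I}, T \subset Y -> f T = g T) ->
  state_sum P Y f = state_sum P Y g.
Proof. by move=> eq_fg; apply: eq_bigr => T /eq_fg ->. Qed.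

Lemma state_sum_setU1 (I : finType) (P Y : {set I}) (f : {set I} -> F) x :
    x \notin Y ->
  state_sum P (x |: Y) f =
  state_sum P Y (fun T => spin_weight (x \in P) * f (x |: T) +
                          spin_weight (x \notin P) * f T).
Proof.
move=> xY; rewrite /state_sum (bigID (fun T : {set I} => x \in T)) /=.
under [RHS]eq_bigr do rewrite mulrDr.
rewrite big_split /=; congr (_ + _).
- rewrite (reindex_onto (fun T => x |: T) (fun T => T :\ x)) /=; last first.
    by move=> T /andP[_ xT]; rewrite setD1K.
  apply: eq_big => [T|T /andP[/andP[TY _] /eqP xT]].
    rewrite setU11 andbT; apply/andP/idP => [[TxY /eqP defT]|TY].
      by rewrite -defT subDset.
    by rewrite setUS // setU1K //; apply: contra xY; apply: subsetP.
  have xnT : x \notin T by rewrite -xT setD11.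
  rewrite big_setU1 //= setU11.
  have -> : (true == (x \in P)) = (x \in P) by case: (x \in P).
  rewrite -mulrA mulrCA; congr (_ * (_ * _)).
  apply: eq_bigr => i iY; rewrite !inE.
  by have /negPf-> : i != x by apply: contraNneq xY => <-.
apply: eq_big => [T|T /andP[TxY xT]].
  apply/andP/idP => [[TxY xT]|TY].
    by rewrite -(setU1K xY); apply/subsetD1P.
  split; first exact: subset_trans TY (subsetUr _ _).
  by apply: contra xY; apply: subsetP.
rewrite big_setU1 //= (negPf xT) -mulrA mulrCA.
by case: (x \in P).
Qed.

(** Renumbering: this is what transports a state sum of a minor, whose vectors
    are renumbered, to the indices of the original arrangement. *)
Lemma state_sum_imset (I J : finType) (h : I -> J) (P : {set J}) (Y : {set I})
    (f : {set J} -> F) :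
    injective h ->
  state_sum P (h @: Y) f = state_sum (h @^-1: P) Y (fun T => f (h @: T)).
Proof.
move=> h_inj; rewrite /state_sum.
have hK (T : {set I}) : h @^-1: (h @: T) = T.
  by apply/setP => i; rewrite inE mem_imset.
rewrite (reindex_onto (fun T : {set I} => h @: T)
                      (fun T : {set J} => h @^-1: T)) /=; last first.
  move=> T TY; apply/setP => j; apply/imsetP/idP => [[i]|jT].
    by rewrite inE => ? ->.
  have /imsetP[i _ def_j] := subsetP TY j jT.
  by exists i; rewrite // inE -def_j.
apply: eq_big => [T|T _]; first by rewrite hK eqxx andbT sub_imset_pre hK.
rewrite big_imset /=; last by move=> ? ? _ _; apply: h_inj.
by congr (_ * _); apply: eq_bigr => i _; rewrite mem_imset // inE.
Qed.

Lemma spin_weightN b : u != 0 -> spin_weight (~~ b) = (spin_weight b)^-1.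
Proof. by case: b; rewrite /= ?invrK. Qed.

(** The value of a loop in the Kauffman bracket; it is symmetric in u and u^-1
    ([loop_valueE]), so a skein identity and its mirror image have one proof. *)
Definition loop_value : F := - (u ^+ 2 + u ^- 2).

Lemma loop_valueE b :
  loop_value = - (spin_weight b ^+ 2 + spin_weight b ^- 2).
Proof. by case: b => //=; rewrite exprVn invrK addrC. Qed.

(** The power of the loop value of exponent n - 2k, which may be negative. *)
Definition loop_term (n k : nat) : F := loop_value ^+ n / loop_value ^+ k.*2.

End StateSum.

(** * The skein identities of the moves *)

Section Skein.
Variables (F : fieldType) (u : F) (I : finType) (P : {set I}).
Hypothesis u0 : u != 0.
Notation d := (loop_value u).
Hypothesis d0 : d != 0.
Implicit Types (f : {set I} -> F).

Lemma spin_weight_neq0 b : spin_weight u b != 0.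
Proof. by case: b; rewrite ?invr_eq0. Qed.

Lemma loop_termS n k : loop_term u n.+1 k = d * loop_term u n k.
Proof. by rewrite /loop_term exprS mulrA. Qed.

(** Adding to a state a vector independent of it divides its term by d. *)
Lemma loop_termSS n k : loop_term u n.+1 k.+1 = loop_term u n k / d.
Proof.
rewrite /loop_term doubleS !exprS.
move: d d0 => e e0; field.
by rewrite expf_neq0 ?e0.
Qed.

(** As the signs differ, the states with both or neither of l and m have weight
    1, and the states with exactly one of them have weights u^2 and u^-2. *)
Lemma state_sum_pair l m f :
    (l \in P) != (m \in P) ->
  state_sum u P setT f =
  state_sum u P (~: [set l; m]) (fun T =>
    f T + f (l |: (m |: T)) + spin_weight u (l \in P) ^+ 2 * f (l |: T)
    + spin_weight u (l \in P) ^- 2 * f (m |: T)).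
Proof.
move=> lmP; have lm : l != m by apply: contraNneq lmP => ->.
have setTE : setT = m |: (l |: ~: [set l; m]) :> {set I}.
  by apply/setP => i; rewrite !inE orbA [(i == m) || _]orbC orbN.
rewrite setTE state_sum_setU1; last first.
  by rewrite !inE eqxx orbT orbF eq_sym.
rewrite state_sum_setU1; last by rewrite !inE eqxx.
apply: eq_state_sum => T _.
have -> : m \in P = (l \notin P) by move: lmP; do 2!case: (_ \in P).
rewrite negbK !spin_weightN // setUCA.
field; exact: spin_weight_neq0.
Qed.

(** With f(l) = f(m) = x, the three states that use l or m contribute
    (d + u^2 + u^-2) x = 0. *)
Lemma state_sum_parallel l m f :
    (l \in P) != (m \in P) ->
    (forall T : {set I}, T \subset ~: [set l; m] ->
       f (m |: T) = f (l |: T) /\ f (l |: (m |: T)) = d * f (l |: T)) ->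
  state_sum u P setT f = state_sum u P (~: [set l; m]) f.
Proof.
move=> /state_sum_pair -> flm; apply: eq_state_sum => T /flm[-> ->].
rewrite (loop_valueE u (l \in P)).
by move: (spin_weight u _) (spin_weight_neq0 (l \in P)) => x x0; field.
Qed.

(** The states with exactly one of l and m contribute (u^2 + u^-2) / d = -1
    times the state with neither, and cancel it. *)
Lemma state_sum_series l m f :
    (l \in P) != (m \in P) ->
    (forall T : {set I}, T \subset ~: [set l; m] ->
       f (l |: T) = f T / d /\ f (m |: T) = f T / d) ->
  state_sum u P setT f =
  state_sum u P (~: [set l; m]) (fun T => f (l |: (m |: T))).
Proof.
move=> /state_sum_pair -> flm; apply: eq_state_sum => T /flm[-> ->].
transitivity (f T + f (l |: (m |: T)) - d * (f T / d)).
  rewrite {3}(loop_valueE u (l \in P)).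
  move: (spin_weight u _) (spin_weight_neq0 (l \in P)) (_ / d) => x x0 y.
  by field.
by rewrite mulrCA mulfV // mulr1 addrAC subrr add0r.
Qed.

(** The star-triangle relation.  Here f is the summand before the move, and
    g e the one after it, e telling whether the state uses the new index, whose
    sign is opposite to that of l.  The states lm, lp and mp on the left match
    the states m, p and the new index alone on the right.  What remains is, with
    f the value of T, f' that of l |: (m |: (p |: T)) and x the weight of l,
      x^-1 f + (2 x + x^-3) f / d + x f'   on the left,
      x f / d + (2 x + x^-3) f' + x^-1 d f'   on the right,
    and both are equal to x (f / d + f'), because x + x^-3 = - x^-1 d. *)
Lemma state_sum_triangle l m p b f (g : bool -> {set I} -> F) :
    l != m -> (l \in P) = b -> (m \in P) = b -> (p \in P) = ~~ b ->
    (forall T : {set I}, T \subset ~: [set l; m; p] ->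
      [/\ f (l |: T) = f T / d, f (m |: T) = f T / d & f (p |: T) = f T / d] /\
      [/\ g false T = f (l |: T), g false (m |: T) = f (l |: (m |: T)),
          g false (p |: T) = f (l |: (p |: T)) &
          g true T = f (m |: (p |: T))] /\
      [/\ g false (m |: (p |: T)) = f (l |: (m |: (p |: T))),
          g true (m |: T) = f (l |: (m |: (p |: T))),
          g true (p |: T) = f (l |: (m |: (p |: T))) &
          g true (m |: (p |: T)) = d * f (l |: (m |: (p |: T)))]) ->
  state_sum u P setT f =
  state_sum u P (~: [set l]) (fun T =>
    spin_weight u (~~ b) * g true T + spin_weight u b * g false T).
Proof.
move=> lm lP mP pP fg.
have pl : p != l by apply: contra_eq_neq pP => ->; rewrite lP; case: (b).
have pm : p != m by apply: contra_eq_neq pP => ->; rewrite mP; case: (b).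
have setlE : ~: [set l] = m |: (p |: ~: [set l; m; p]) :> {set I}.
  apply/setP => i; rewrite !inE !negb_or.
  have [->|im] := eqVneq i m; first by rewrite eq_sym lm.
  by have [->|ip] := eqVneq i p; rewrite ?andbT // pl.
have setTE : setT = l |: ~: [set l] :> {set I}.
  by apply/setP => i; rewrite !inE orbN.
have mY : m \notin p |: ~: [set l; m; p].
  by rewrite !inE eq_sym (negPf pm) eqxx orbT.
have pY : p \notin ~: [set l; m; p] by rewrite !inE eqxx orbT.
rewrite setTE state_sum_setU1 ?inE ?eqxx // setlE.
rewrite !(state_sum_setU1 _ _ _ mY) !(state_sum_setU1 _ _ _ pY).
apply: eq_state_sum => T /fg[[fl fm fp] [[g0 gm gp g1] [gmp g1m g1p g1mp]]].
rewrite lP mP pP negbK spin_weightN //.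
rewrite gm gp g1 gmp g1m g1p g1mp g0 fm fp fl.
have := loop_valueE u b; have := spin_weight_neq0 b; have := d0.
move: (loop_value u) (spin_weight u b) => e x e0 x0 e_def.
have e1 : - (x ^+ 2 + x ^- 2) != 0 by rewrite -e_def.
rewrite e_def; field; rewrite x0; apply: contraNneq e1 => e_num.
have -> : - (x ^+ 2 + x ^- 2) = - ((x * x) ^+ 2 + 1) / x ^+ 2 by field.
by rewrite e_num mul0r.
Qed.

End Skein.

(** * Dimensions of orthogonal subspaces and projections *)

Section OrthogonalDimension.
Variables (K : fieldType) (V : vectType K) (f : {symmetric V}).
Implicit Types U X : {vspace V}.

Lemma orthov_span_codim (s : seq V) :
  (\dim {:V} <= \dim (orthov f <<s>>) + size s)%N.
Proof.
elim: s => [|v s IH]; first by rewrite span_nil orthov0 addn0.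
have defo : orthov f <<v :: s>> = (orthov f <<s>> :&: orthov f <[v]>)%VS.
  apply/vspaceP => x; apply/idP/idP => [x_o|/memv_capP[x_s x_v]].
    rewrite span_cons in x_o.
    by rewrite memv_cap !memvE; move: x_o; rewrite memvE orthovD andbC.
  by rewrite span_cons memvE orthovD -!memvE x_v.
apply: leq_trans IH _; rewrite /= defo addnS -addSn leq_add2r.
have := leq_dim_orthov1 f v (orthov f <<s>>).
lia.
Qed.

(** This inequality holds for every form; [dim_orthov] turns it into an equality
    by applying it to [U] and to a complement of [U], whose orthogonals meet
    only in 0 when the form is nondegenerate. *)
Lemma orthov_codim U : (\dim {:V} <= \dim (orthov f U) + \dim U)%N.
Proof.
have := orthov_span_codim (vbasis U).
by rewrite (span_basis (vbasisP U)) size_tuple.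
Qed.

Lemma dim_orthov U : nondegenerate f ->
  (\dim (orthov f U) + \dim U)%N = \dim {:V}.
Proof.
move=> nd; apply/eqP; rewrite eqn_leq orthov_codim andbT.
have cap0 : (orthov f U :&: orthov f U^C)%VS = 0%VS.
  apply/eqP; rewrite -subv0 -(eqP nd); apply/subvP => x.
  by rewrite memv_cap !memvE -orthovD addv_complf.
have := dimv_sum_cap (orthov f U) (orthov f U^C).
rewrite cap0 dimv0 addn0 => dim_sum.
have le_sum : (\dim (orthov f U) + \dim (orthov f U^C) <= \dim {:V})%N.
  by rewrite -dim_sum dimvS ?subvf.
have := orthov_codim U^C; rewrite dimv_compl => le_C.
have le_U : (\dim U <= \dim {:V})%N by rewrite dimvS ?subvf.
lia.
Qed.

(** [oproj] as a bundled linear map, for the sake of images of subspaces. *)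
Definition oproj_lin U : 'Hom(V, subvs_of U) :=
  (linfun (vsproj U) \o daddv_pi U (orthov f U))%VF.

Lemma oproj_linE U v : oproj_lin U v = oproj f U v.
Proof. by rewrite comp_lfunE lfunE. Qed.

(** The orthogonal of [U] is the kernel of the projection onto [U]. *)
Lemma dim_oproj U X : nondegenerate f -> (U :&: orthov f U = 0)%VS ->
  (\dim (oproj_lin U @: X) + \dim (orthov f U))%N = \dim (X + orthov f U)%VS.
Proof.
move=> nd UU0.
have fullE : (U + orthov f U)%VS = fullv.
  apply/eqP; rewrite eqEdim subvf /=.
  by rewrite -(dim_orthov U nd) dimv_disjoint_sum // addnC.
have kerE : lker (oproj_lin U) = orthov f U.
  apply/vspaceP => x; rewrite memv_ker oproj_linE /oproj.
  have def_x : daddv_pi U (orthov f U) x + daddv_pi (orthov f U) U x = x.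
    by apply: daddv_pi_add; rewrite // fullE memvf.
  apply/eqP/idP => [/(congr1 vsval)|xo].
    rewrite vsprojK ?memv_pi // linear0 => px0.
    by rewrite -def_x px0 add0r memv_pi.
  suff -> : daddv_pi U (orthov f U) x = 0 by rewrite linear0.
  apply/eqP; rewrite -memv0 -UU0 memv_cap memv_pi.
  rewrite -[daddv_pi _ _ x](addrK (daddv_pi (orthov f U) U x)) def_x.
  by rewrite rpredB ?memv_pi.
have := limg_ker_dim (oproj_lin U) X; have := dimv_sum_cap X (orthov f U).
rewrite kerE; lia.
Qed.

End OrthogonalDimension.

(** * The framed Jones polynomial as a rank generating function *)

Section ArrangementRank.
Variables (K : fieldType) (A : arrangement K).
Notation n := (nvec A).
Notation V := (ambient A).
Implicit Types T D : {set 'I_n}.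

Definition span_on T : {vspace V} := (\sum_(i in T) <[vec i]>)%VS.

Definition rk T : nat := \dim (span_on T).

Lemma span_onU1 i T : span_on (i |: T) = (<[vec i]> + span_on T)%VS.
Proof.
have [iT|iT] := boolP (i \in T); last by rewrite /span_on big_setU1.
rewrite (setUidPr _) ?sub1set //; apply/esym/addv_idPr.
exact: (sumv_sup i).
Qed.

Lemma span_on1 i : span_on [set i] = <[vec i]>%VS.
Proof. by rewrite /span_on big_set1. Qed.

Lemma span_onU T D : span_on (T :|: D) = (span_on T + span_on D)%VS.
Proof.
apply: subv_anti; apply/andP; split.
  apply/subv_sumP => i; rewrite inE => /orP[iT|iD].
    by apply: subv_trans (addvSl _ _); apply: (sumv_sup i).
  by apply: subv_trans (addvSr _ _); apply: (sumv_sup i).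
rewrite subv_add; apply/andP; split; apply/subv_sumP => i iX.
  by apply: (sumv_sup i); rewrite // inE iX.
by apply: (sumv_sup i); rewrite // inE iX orbT.
Qed.

Lemma flatE T : flat T = orthov (dot A) (span_on T).
Proof.
apply: subv_anti; apply/andP; split.
  rewrite orthov_sym; apply/subv_sumP => i iT; rewrite orthov_sym.
  exact: (bigcapv_inf i).
apply/subv_bigcapP => i iT; rewrite orthov_sym.
apply: (@subv_trans _ _ (span_on T)); first exact: (sumv_sup i).
by rewrite orthov_sym.
Qed.

Lemma dim_flat T : (\dim (flat T) + rk T)%N = \dim {:V}.
Proof. by rewrite flatE; apply: dim_orthov; apply: dot_nondeg. Qed.

Lemma orthov_flat T : orthov (dot A) (flat T) = span_on T.
Proof.
apply/esym/eqP; rewrite eqEdim flatE orthov_sym subvv /=.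
have := dim_orthov (orthov (dot A) (span_on T)) (dot_nondeg A).
have := dim_orthov (span_on T) (dot_nondeg A).
lia.
Qed.

(** Vectors of coefficients supported on [T]: [relations_on T] is the kernel of
    [lincomb] on this space, and [span_on T] is its image. *)
Definition coordinate_space T : {vspace 'rV[K]_n} :=
  (\sum_(i in T) <[delta_mx 0%R i]>)%VS.

Lemma coordinate_spaceE T :
  coordinate_space T = (\bigcap_(r in ~: T) lker (linfun (@entry K A r)))%VS.
Proof.
apply: subv_anti; apply/andP; split.
  apply/subv_sumP => i iT; apply/subv_bigcapP => r; rewrite inE => rT.
  rewrite -memvE memv_ker lfunE /= /entry mxE eqxx.
  by have /negPf-> : r != i by apply: contraNneq rT => ->.
apply/subvP => w; rewrite memvE => /subv_bigcapP w0.
rewrite (row_sum_delta w); apply: rpred_sum => i _.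
have [iT|iT] := boolP (i \in T).
  by rewrite memvZ // memvE (sumv_sup i).
have := w0 i; rewrite inE -memvE memv_ker lfunE => /(_ iT)/eqP.
by rewrite /= /entry => ->; rewrite scale0r mem0v.
Qed.

Lemma dim_coordinate_space T : \dim (coordinate_space T) = #|T|.
Proof.
have le_dim (X : {set 'I_n}) : (\dim (coordinate_space X) <= #|X|)%N.
  apply: leq_trans (dimv_leq_sum _ _ _) _.
  by rewrite -sum1_card leq_sum // => i _; rewrite dim_vline leq_b1.
have fullE : (coordinate_space T + coordinate_space (~: T) = fullv)%VS.
  apply/eqP; rewrite eqEsubv subvf /=; apply/subvP => w _.
  rewrite (row_sum_delta w); apply: rpred_sum => i _; apply: memvZ.
  rewrite memvE; have [iT|iT] := boolP (i \in T).
    by apply: subv_trans (addvSl _ _); apply: (sumv_sup i).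
  by apply: subv_trans (addvSr _ _); apply: (sumv_sup i); rewrite // inE.
have := dimv_sum_cap (coordinate_space T) (coordinate_space (~: T)).
rewrite fullE dimvf dim_matrix.
have := le_dim T; have := le_dim (~: T); have := cardsC T.
by rewrite card_ord; lia.
Qed.

Lemma lincomb_delta i : lincomb (delta_mx 0 i : 'rV[K]_n) = vec i :> V.
Proof.
rewrite /lincomb (bigD1 i) //= mxE !eqxx scale1r big1 ?addr0 // => j ji.
by rewrite mxE (negPf ji) andbF scale0r.
Qed.

Lemma limg_coordinate_space T :
  (linfun (@lincomb K A) @: coordinate_space T)%VS = span_on T.
Proof.
rewrite limg_sum; apply: eq_bigr => i _.
by rewrite limg_line lfunE /= lincomb_delta.
Qed.

Lemma dim_relations_on T : (\dim (relations_on T) + rk T)%N = #|T|.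
Proof.
rewrite /relations_on -coordinate_spaceE capvC /rk -limg_coordinate_space.
by rewrite limg_ker_dim dim_coordinate_space.
Qed.

(** A coefficient vector whose combination lies in the span of [T] becomes a
    relation after a change of its entries in [T] alone.  This is how a
    hypothesis on covectors, that is on relations, gives linear independence. *)
Lemma relation_extending T (w : 'rV[K]_n) :
    lincomb w \in @span_on T ->
  exists2 w' : 'rV[K]_n, w' \in relations A &
    forall i, i \notin T -> w' 0 i = w 0 i.
Proof.
rewrite -limg_coordinate_space coordinate_spaceE => /memv_imgP[c c_T def_w].
exists (w - c).
  by rewrite memv_ker lfunE /= linearB /= def_w lfunE subrr.
move=> i iT; rewrite !mxE; move: c_T; rewrite memvE => /subv_bigcapP/(_ i).
rewrite inE -memvE memv_ker lfunE => /(_ iT)/eqP.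
by rewrite /= /entry => ->; rewrite subr0.
Qed.

End ArrangementRank.

(** The variable of the Kauffman bracket, (-1)^(1/2) q^(1/2). *)
Definition kauffman_u : {fraction {poly algC}} := imag * sqrtq.

Definition rank_term (N k : nat) := loop_term kauffman_u N k.

Lemma sqrtq_neq0 : sqrtq != 0.
Proof. by rewrite /sqrtq tofrac_eq0 polyX_eq0. Qed.

Lemma imag2 : imag ^+ 2 = -1.
Proof.
rewrite /imag -tofracXn -polyC_exp Num.Theory.sqrCi polyCN.
by rewrite tofracN tofrac1.
Qed.

Lemma imag_neq0 : imag != 0.
Proof.
apply: contra_eq_neq imag2 => ->.
by rewrite expr0n eq_sym oppr_eq0 oner_eq0.
Qed.

Lemma kauffman_u_neq0 : kauffman_u != 0.
Proof. exact: mulf_neq0 imag_neq0 sqrtq_neq0. Qed.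

Lemma loop_valueM (F : fieldType) (i s : F) :
  i ^+ 2 = -1 -> loop_value (i * s) = s ^+ 2 + (s ^+ 2)^-1.
Proof.
by move=> i2; rewrite /loop_value exprMn i2 mulN1r invrN opprD !opprK.
Qed.

Lemma kauffman_loop : loop_value kauffman_u = sqrtq ^+ 2 + (sqrtq ^+ 2)^-1.
Proof. exact: loop_valueM imag2. Qed.

Lemma kauffman_loop_neq0 : loop_value kauffman_u != 0.
Proof.
have sum_neq0 : sqrtq ^+ 4 + 1 != 0.
  rewrite /sqrtq -tofracXn -tofrac1 -tofracD tofrac_eq0.
  by rewrite -size_poly_eq0 -['X^4 + 1]/('X^4 + 1%:P) size_XnaddC.
rewrite kauffman_loop; apply: contraNneq sum_neq0 => loop0.
have -> : sqrtq ^+ 4 + 1 = (sqrtq ^+ 2 + (sqrtq ^+ 2)^-1) * sqrtq ^+ 2.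
  by rewrite mulrDl mulVf ?expf_neq0 ?sqrtq_neq0 // -exprD.
by rewrite loop0 mul0r.
Qed.

Lemma framed_jonesE (K : fieldType) (A : arrangement K) :
  framed_jones A = state_sum kauffman_u (pos A) setT
    (fun T => rank_term (\dim {:ambient A} + #|T|) (rk T)).
Proof.
have twistE (S : {set 'I_(nvec A)}) i :
    (i \in twist S) = ((i \in S) == (i \in pos A)).
  by rewrite !inE; case: (i \in S); case: (i \in pos A).
have twistK : involutive (@twist K A).
  by move=> S; apply/setP => i; rewrite !twistE; do 2!case: (_ \in _).
rewrite /framed_jones /state_sum [RHS](reindex_inj (inv_inj twistK)) /=.
apply: eq_big => [S|S _]; first by rewrite subsetT.
rewrite -expfzMl -/kauffman_u -kauffman_loop; congr (_ * _).
  rewrite (eq_bigr (fun i => spin_weight kauffman_u (i \in S))); last first.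
    by move=> i _; rewrite twistE; do 2!case: (_ \in _).
  rewrite (eq_bigl predT); last by move=> i; rewrite inE.
  rewrite (bigID (mem S)) /=.
  rewrite (eq_bigr (fun=> kauffman_u)) => [|i ->] //.
  rewrite [X in _ * X](eq_bigr (fun=> kauffman_u^-1)) => [|i /negPf->] //.
  rewrite [X in _ * X](eq_bigl (mem (~: S))) => [|i]; last by rewrite /= inE.
  rewrite !prodr_const exprVn.
  transitivity (kauffman_u ^ (#|S|%:Z - #|~: S|%:Z)).
    congr (_ ^ _); rewrite -[X in _ - X%:Z]card_ord -(cardsC S).
    by rewrite -addnn !PoszD opprD addrACA subrr add0r.
  by rewrite expfzDr ?kauffman_u_neq0 // -exprnN.
rewrite /rank_term /loop_term.
have -> : (\dim {:ambient A} + #|twist S|)%N = (\dim (flat (twist S)) +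
   \dim (relations_on (twist S)) + (rk (twist S)).*2)%N.
  by have := dim_flat (twist S); have := dim_relations_on (twist S); lia.
by rewrite [in RHS]exprD mulfK // expf_neq0 // kauffman_loop_neq0.
Qed.


(** * Minors and extensions *)

Section Minors.
Variables (K : fieldType) (A : arrangement K).
Implicit Types T D : {set 'I_(nvec A)}.

Lemma imset_enum_val D : enum_val @: [set: 'I_#|D|] = D.
Proof.
apply/setP => i; apply/imsetP/idP => [[j _ ->]|iD]; first exact: enum_valP.
by exists (enum_rank_in iD i); rewrite ?enum_rankK_in.
Qed.

Lemma framed_jones_deletion D :
  framed_jones (deletion A D) = state_sum kauffman_u (pos A) (~: D)
    (fun T => rank_term (\dim {:ambient A} + #|T|) (rk T)).
Proof.
rewrite framed_jonesE -(imset_enum_val (~: D)).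
rewrite state_sum_imset; last exact: enum_val_inj.
apply: eq_state_sum => T _; rewrite card_imset; last exact: enum_val_inj.
congr (rank_term _ (\dim _)); rewrite [RHS]big_imset //.
by move=> i j _ _; apply: enum_val_inj.
Qed.

Lemma span_on_restriction D (nd : nondeg_on (flat D))
    (T : {set 'I_(nvec (restriction A D nd))}) :
  span_on T = (oproj_lin (dot A) (flat D) @: @span_on K A (enum_val @: T))%VS.
Proof.
rewrite /span_on [in RHS]big_imset; last by move=> i j _ _; apply: enum_val_inj.
by rewrite limg_sum; apply: eq_bigr => i _; rewrite limg_line oproj_linE.
Qed.

Lemma dim_restriction D (nd : nondeg_on (flat D)) (X : {vspace ambient A}) :
  (\dim (oproj_lin (dot A) (flat D) @: X) + rk D)%N = \dim (X + span_on D).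
Proof. by rewrite /rk -(orthov_flat D) dim_oproj ?dot_nondeg //; apply/eqP. Qed.

(** Contraction of [D] lowers the dimension of the space by [rk D] and each rank
    by [rk D] as well, which makes the exponent dim V + N - 2 rank grow by
    [rk D]. *)
Lemma rank_term_restriction D (nd : nondeg_on (flat D))
    (X : {vspace ambient A}) N :
  rank_term (\dim {:ambient (restriction A D nd)} + N)
    (\dim (oproj_lin (dot A) (flat D) @: X)) =
  rank_term (\dim {:ambient A} + N + rk D) (\dim (X + span_on D)).
Proof.
rewrite -(dim_restriction nd) -(dim_flat D) dimvf.
have -> : dim (ambient (restriction A D nd)) = \dim (flat D) by [].
rewrite /rank_term /loop_term.
set r := rk D; set c := \dim (_ @: _).
have -> : (\dim (flat D) + r + N + r = \dim (flat D) + N + r.*2)%N by lia.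
rewrite doubleD.
rewrite !(exprD _ _ r.*2) invfM mulrACA mulfV ?mulr1 //.
by rewrite expf_neq0 // kauffman_loop_neq0.
Qed.

Lemma framed_jones_restriction D (nd : nondeg_on (flat D)) :
  framed_jones (restriction A D nd) = state_sum kauffman_u (pos A) (~: D)
    (fun T => rank_term (\dim {:ambient A} + #|T| + rk D)
       (\dim (span_on T + span_on D))).
Proof.
rewrite framed_jonesE -(imset_enum_val (~: D)).
rewrite state_sum_imset; last exact: enum_val_inj.
apply: eq_state_sum => T _; rewrite card_imset; last exact: enum_val_inj.
by rewrite /rk span_on_restriction rank_term_restriction.
Qed.

Lemma framed_jones_extension v s :
  framed_jones (extension A v s) = state_sum kauffman_u (pos A) setT
    (fun T =>
      spin_weight kauffman_u s *
        rank_term (\dim {:ambient A} + #|T|.+1) (\dim (<[v]> + span_on T)) +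
      spin_weight kauffman_u (~~ s) *
        rank_term (\dim {:ambient A} + #|T|) (rk T)).
Proof.
set B := extension A v s; set n := nvec A.
pose top : 'I_n.+1 := ord_max.
have liftK (i : 'I_n) : unlift top (lift top i) = Some i by rewrite liftK.
have lift_inj : injective (lift top) by apply: lift_inj.
have topP : (top \in pos B) = s by rewrite inE unlift_none.
have topY : top \notin lift top @: [set: 'I_n].
  by apply/imsetP => -[i _] /eqP; rewrite (negPf (neq_lift _ _)).
have setTE : [set: 'I_n.+1] = top |: lift top @: [set: 'I_n].
  apply/setP => i; rewrite !inE; apply/esym.
  by case: (unliftP top i) => [j ->|->]; rewrite ?eqxx // imset_f ?orbT.
have posE : lift top @^-1: pos B = pos A.
  by apply/setP => i; rewrite !inE liftK.
have spanE (T : {set 'I_n}) : @span_on K B (lift top @: T) = span_on T.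
  rewrite /span_on big_imset /=; last by move=> i j _ _; apply: lift_inj.
  by apply: eq_bigr => i _; rewrite liftK.
rewrite framed_jonesE setTE state_sum_setU1 // state_sum_imset // posE.
apply: eq_state_sum => T _; rewrite topP /rk span_onU1 spanE /=.
rewrite unlift_none cardsU1 card_imset // (_ : top \notin _) ?add1n //.
by apply: contra topY; apply: subsetP; apply: imsetS; apply: subsetT.
Qed.

End Minors.

(** * Invariance under the moves *)

Lemma dim_add_line (K : fieldType) (V : vectType K) (U : {vspace V}) v :
  v \notin U -> \dim (<[v]> + U) = (\dim U).+1.
Proof.
move=> vU; rewrite dimv_disjoint_sum ?dim_vline.
  by have -> : v != 0 by apply: contraNneq vU => ->; rewrite mem0v.
apply/eqP; rewrite -subv0; apply/subvP => x /memv_capP[/vlineP[k ->] kvU].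
have [->|k0] := eqVneq k 0; first by rewrite scale0r mem0v.
by case/negP: vU; rewrite -[v]scale1r -(mulVf k0) -scalerA memvZ.
Qed.

Section Moves.
Variables (K : fieldType) (A : arrangement K).
Notation n := (nvec A).
Implicit Types (T D : {set 'I_n}) (l m p : 'I_n).

(** The hypothesis is stated with lines in order to cover two zero vectors. *)
Lemma framed_jones_parallel l m :
    opposite_signs l m -> (<[vec l]> = <[vec m]>)%VS ->
  framed_jones A = framed_jones (deletion A [set l; m]).
Proof.
move=> lmP line_lm; rewrite framed_jones_deletion framed_jonesE.
have lm : l != m by apply: contraNneq lmP => ->.
apply: state_sum_parallel => //; first exact: kauffman_u_neq0.
move=> T TY.
have lT : l \notin T by apply/negP => /(subsetP TY); rewrite !inE eqxx.
have mT : m \notin T by apply/negP => /(subsetP TY); rewrite !inE eqxx orbT.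
have lmT : l \notin m |: T by rewrite !inE negb_or lm lT.
rewrite !cardsU1 lmT lT mT /= !add1n !addnS /rk !span_onU1 line_lm.
by rewrite addvA addvv [rank_term _.+2 _]loop_termS.
Qed.

(** The vectors l and m are in series when neither lies in the span of vectors
    away from the pair; the case of two coloops is included. *)
Lemma framed_jones_series l m (nd : nondeg_on (flat [set l; m])) :
    opposite_signs l m -> vec l \notin <[vec m]>%VS ->
    (forall T, T \subset ~: [set l; m] ->
      vec l \notin span_on T /\ vec m \notin span_on T) ->
  framed_jones A = framed_jones (restriction A [set l; m] nd).
Proof.
move=> lmP l_m indep.
have m0 : vec m != 0.
  have [_] := indep set0 (sub0set _); apply: contraNneq => ->; exact: mem0v.
have rk2 : rk [set l; m] = 2.
  by rewrite /rk span_onU1 span_on1 dim_add_line // dim_vline m0.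
rewrite framed_jones_restriction framed_jonesE rk2.
have lm : l != m by apply: contraNneq lmP => ->.
have insert T : T \subset ~: [set l; m] -> l \notin T /\ m \notin T.
  move=> TY; split; apply/negP => /(subsetP TY); rewrite !inE eqxx //.
  by rewrite orbT.
rewrite (state_sum_series kauffman_u_neq0 kauffman_loop_neq0 lmP).
  apply: eq_state_sum => T /insert[lT mT].
  have lmT : l \notin m |: T by rewrite !inE negb_or lm lT.
  rewrite !cardsU1 lmT mT /= !add1n !addnS addn0; congr (rank_term _ _).
  by rewrite /rk setUA span_onU addvC.
move=> T TY; have [lT mT] := insert T TY; have [lS mS] := indep T TY.
rewrite !cardsU1 lT mT /= !add1n !addnS /rk !span_onU1 !dim_add_line //.
by split; apply: loop_termSS kauffman_loop_neq0 _ _.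
Qed.

(** The relation between coordinates says that x l + y m + z p lies in the span
    of the other vectors only if x = am y + ap z.  Hence l, m and p do not lie
    in U = span T; and l and m do not lie in U + <c>, where c = ap m - am p
    represents the new vector, because c is itself a combination with
    am y + ap z = 0.  This gives all the ranks that the star-triangle relation
    compares. *)
Lemma framed_jones_triangle l m p (am ap : K)
    (nd : nondeg_on (flat [set l])) b :
    l != m -> (l \in pos A) = b -> (m \in pos A) = b -> (p \in pos A) = ~~ b ->
    am != 0 -> ap != 0 ->
    {in relations A, forall w : 'rV[K]_n, w 0 l = am * w 0 m + ap * w 0 p} ->
  framed_jones A = framed_jones (R3_target m p am ap nd (~~ b)).
Proof.
move=> lm lP mP pP am0 ap0 rel_lmp.
pose c : ambient A := ap *: vec m - am *: vec p.
pose g (s : bool) T :=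
  if s then rank_term (\dim {:ambient A} + #|T|.+1 + rk [set l])
              (\dim (<[c]> + span_on T + span_on [set l]))
  else rank_term (\dim {:ambient A} + #|T| + rk [set l])
              (\dim (span_on T + span_on [set l])).
transitivity (state_sum kauffman_u (pos A) (~: [set l]) (fun T =>
    spin_weight kauffman_u (~~ b) * g true T +
    spin_weight kauffman_u b * g false T)); last first.
  rewrite /R3_target framed_jones_extension negbK.
  rewrite -(imset_enum_val (~: [set l])).
  rewrite state_sum_imset; last exact: enum_val_inj.
  apply: eq_state_sum => T _; rewrite /g -!rank_term_restriction.
  rewrite limgD limg_line linearB !linearZ /= !oproj_linE.
  by rewrite card_imset ?/rk ?span_on_restriction //; apply: enum_val_inj.
rewrite framed_jonesE.
apply: (state_sum_triangle kauffman_u_neq0 kauffman_loop_neq0 lm lP mP pP).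
move=> T TY.
have pl : p != l by apply: contra_eq_neq pP => ->; rewrite lP; case: (b).
have pm : p != m by apply: contra_eq_neq pP => ->; rewrite mP; case: (b).
have lT : l \notin T by apply/negP => /(subsetP TY); rewrite !inE eqxx.
have mT : m \notin T by apply/negP => /(subsetP TY); rewrite !inE eqxx orbT.
have pT : p \notin T by apply/negP => /(subsetP TY); rewrite !inE eqxx !orbT.
have mpT : m \notin p |: T by rewrite !inE negb_or eq_sym pm mT.
have lmT : l \notin m |: T by rewrite !inE negb_or lm lT.
have lpT : l \notin p |: T by rewrite !inE negb_or eq_sym pl lT.
have lmpT : l \notin m |: (p |: T) by rewrite in_setU1 negb_or lm.
set U := span_on T.
have indep x y z :
  x *: vec l + y *: vec m + z *: vec p \in U -> x = am * y + ap * z.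
  (* T avoids l, m and p, so w' has the same entries there as w *)
  pose w : 'rV[K]_n :=
    x *: delta_mx 0 l + y *: delta_mx 0 m + z *: delta_mx 0 p.
  have -> : x *: vec l + y *: vec m + z *: vec p = lincomb w.
    by rewrite !linearD !linearZ /= !lincomb_delta.
  case/relation_extending => w' /rel_lmp rel_w' w'E; move: rel_w'.
  rewrite !w'E // !mxE !eqxx /= [m == l]eq_sym (negPf lm) (negPf pl) (negPf pm).
  rewrite [l == p]eq_sym [m == p]eq_sym (negPf pl) (negPf pm).
  by rewrite !(mulr1, mulr0, addr0, add0r).
have lU : vec l \notin U.
  apply/negP => vU; have := indep 1 0 0.
  rewrite scale1r !scale0r !addr0 !mulr0 addr0 => /(_ vU)/eqP.
  by rewrite oner_eq0.
have mU : vec m \notin U.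
  apply/negP => vU; have := indep 0 1 0.
  rewrite scale1r !scale0r !addr0 add0r mulr0 mulr1 addr0 => /(_ vU)/eqP.
  by rewrite eq_sym (negPf am0).
have pU : vec p \notin U.
  apply/negP => vU; have := indep 0 0 1.
  rewrite scale1r !scale0r !add0r mulr0 mulr1 add0r => /(_ vU)/eqP.
  by rewrite eq_sym (negPf ap0).
have cancel_c t (x : ambient A) :
    t *: c + x - (t * ap) *: vec m + (t * am) *: vec p = x.
  rewrite /c scalerBr !scalerA.
  set vm := (t * ap) *: _; set vp := (t * am) *: _.
  rewrite [vm - vp + x - vm]addrAC [vm - vp - vm]addrAC subrr add0r.
  by rewrite addrAC addNr add0r.
have lC : vec l \notin (<[c]> + U)%VS.
  apply/negP => /memv_addP[_ /vlineP[t ->] [x xU def_l]].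
  have := indep 1 (- (t * ap)) (t * am).
  have -> : 1 *: vec l + - (t * ap) *: vec m + (t * am) *: vec p = x.
    by rewrite scale1r scaleNr def_l cancel_c.
  move=> /(_ xU)/eqP.
  have -> : am * - (t * ap) + ap * (t * am) = 0 by ring.
  by rewrite oner_eq0.
have mC : vec m \notin (<[c]> + U)%VS.
  apply/negP => /memv_addP[_ /vlineP[t ->] [x xU def_m]].
  have := indep 0 (1 - (t * ap)) (t * am).
  have -> : 0 *: vec l + (1 - (t * ap)) *: vec m + (t * am) *: vec p = x.
    by rewrite scale0r add0r scalerBl scale1r {1}def_m cancel_c.
  move=> /(_ xU)/eqP.
  have -> : am * (1 - (t * ap)) + ap * (t * am) = am by ring.
  by rewrite eq_sym (negPf am0).
have addCA (X Y Z : {vspace ambient A}) : (X + (Y + Z) = Y + (X + Z))%VS.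
  by rewrite !addvA (addvC X).
have c_mp : (<[c]> <= <[vec m]> + <[vec p]>)%VS.
  by rewrite -memvE rpredB // memvZ // memvE ?addvSl ?addvSr.
(* c is a combination of m and p with nonzero coefficients, so it may replace
   either of them *)
have cm_mp : (<[c]> + <[vec m]> = <[vec m]> + <[vec p]>)%VS.
  apply/eqP; rewrite eqEsubv !subv_add c_mp addvSl addvSr /= -memvE.
  have -> : vec p = am^-1 *: (ap *: vec m - c).
    by rewrite /c opprB addrC subrK scalerA mulVf ?scale1r.
  apply: memvZ; apply: rpredB; last by rewrite memvE addvSl.
  by apply: memvZ; rewrite memvE addvSr.
have cp_mp : (<[c]> + <[vec p]> = <[vec m]> + <[vec p]>)%VS.
  apply/eqP; rewrite eqEsubv !subv_add c_mp !addvSr /= andbT -memvE.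
  have -> : vec m = ap^-1 *: (c + am *: vec p).
    by rewrite /c subrK scalerA mulVf ?scale1r.
  apply: memvZ; apply: rpredD; first by rewrite memvE addvSl.
  by apply: memvZ; rewrite memvE addvSr.
(* the state mp before the move and the new index after it have equal ranks *)
have mpE : \dim (<[vec m]> + (<[vec p]> + U)) = (\dim (<[c]> + U)).+1.
  by rewrite addvA -cm_mp -addvA addCA dim_add_line.
have rk_l : rk [set l] = 1%N.
  rewrite /rk span_on1 dim_vline.
  by have -> : vec l != 0 by apply: contraNneq lU => ->; rewrite mem0v.
rewrite /g !cardsU1 lT mT pT mpT lmT lpT lmpT /= !add1n.
rewrite rk_l span_on1 !addnS !addn0.
rewrite /rk !span_onU1 -/U ![(_ + <[vec l]>)%VS]addvC.
split.
  rewrite !dim_add_line //.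
  by split; apply: loop_termSS kauffman_loop_neq0 _ _.
split.
  by rewrite mpE (dim_add_line lC).
have cmp :
    (<[c]> + (<[vec m]> + (<[vec p]> + U)) = <[vec m]> + (<[vec p]> + U))%VS.
  apply/addv_idPr; rewrite addvA; exact: subv_trans c_mp (addvSl _ _).
rewrite cmp; split=> //; last exact: loop_termS.
  by rewrite [(<[c]> + _)%VS]addvA cm_mp -addvA.
by rewrite [(<[c]> + _)%VS]addvA cp_mp -addvA.
Qed.

End Moves.

Section Reidemeister.
Variable K : fieldType.

Lemma covec_relation (A : arrangement K) (i : 'I_(nvec A))
    (w : 'rV[K]_(nvec A)) :
  w \in relations A -> w 0 i = covec i (vsproj (relations A) w).
Proof. by move=> wR; rewrite covecE vsprojK. Qed.

Lemma relation_of_span (A : arrangement K) (i : 'I_(nvec A))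
    (T : {set 'I_(nvec A)}) :
    vec i \in span_on T ->
  exists2 w : 'rV[K]_(nvec A), w \in relations A &
    forall j, j \notin T -> w 0 j = (j == i)%:R.
Proof.
rewrite -lincomb_delta => /relation_extending[w wR wE].
by exists w => // j jT; rewrite wE // mxE eqxx.
Qed.

Lemma framed_jones_reidemeister (A B : arrangement K) :
  reidemeister A B -> framed_jones A = framed_jones B.
Proof.
case=> [l m l0 m0 lmP|l m nd cl0 cm0 lmP|l m a a0 l_am lmP|
        l m a nd a0 cl_am lmP l_m|l m p am ap nd lm lP mP pP am0 ap0 cl|
        l m p am ap nd lm lP mP pP am0 ap0 cl].
- by apply: framed_jones_parallel => //; rewrite l0 m0.
- have lm : l != m by apply: contraNneq lmP => ->.
  (* a vector with zero covector is not in the span of the others *)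
  have coloop (i : 'I_(nvec A)) (T : {set 'I_(nvec A)}) :
      covec i = 0 -> i \notin T -> vec i \notin span_on T.
    move=> ci0 iT; apply/negP => /relation_of_span[w wR /(_ i iT)/eqP].
    by rewrite covec_relation // ci0 lfunE eqxx eq_sym oner_eq0.
  apply: framed_jones_series => // [|T TY].
    by rewrite -span_on1 coloop // inE.
  split; apply: coloop => //; apply/negP => /(subsetP TY);
    by rewrite !inE eqxx ?orbT.
- apply: framed_jones_parallel => //; rewrite l_am.
  apply/eqP; rewrite eqEsubv -!memvE memvZ ?memv_line //=.
  by rewrite -[X in X \in _]scale1r -(mulVf a0) -scalerA memvZ ?memv_line.
- have lm : l != m by apply: contraNneq lmP => ->.
  have rel_lm (w : 'rV[K]_(nvec A)) : w \in relations A -> w 0 l = a * w 0 m.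
    by move=> wR; rewrite !(covec_relation _ wR) cl_am lfunE.
  apply: framed_jones_series => // T TY.
  have lT : l \notin T by apply/negP => /(subsetP TY); rewrite !inE eqxx.
  have mT : m \notin T by apply/negP => /(subsetP TY); rewrite !inE eqxx orbT.
  split; apply/negP => /relation_of_span[w /rel_lm + wE]; rewrite !wE // eqxx.
    by rewrite eq_sym (negPf lm) mulr0 => /eqP; rewrite oner_eq0.
  by rewrite (negPf lm) mulr1 => /esym/eqP; rewrite (negPf a0).
- apply: (framed_jones_triangle nd lm lP mP (negbTE pP) am0 ap0) => w wR.
  by rewrite !(covec_relation _ wR) cl add_lfunE !scale_lfunE.
- apply: (framed_jones_triangle nd lm (negbTE lP) (negbTE mP) pP am0 ap0).
  move=> w wR.
  by rewrite !(covec_relation _ wR) cl add_lfunE !scale_lfunE.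
Qed.

End Reidemeister.

Theorem proposition3p2 (K : fieldType) (charK : [pchar K] =i pred0)
    (A B : arrangement K) (AB : reidemeister A B \/ reidemeister B A) :
  framed_jones A = framed_jones B.
Proof.
by case: AB => /framed_jones_reidemeister.
Qed.
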